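(* For a singular link $L$ with exactly $r$ double points, we have $$\left[\mathit{Kh}(L;\mathbb F_2)\right]_q=\widetilde V^{(r)}(L),$$ where $\left[\mathit{Kh}(L;\mathbb F_2)\right]_q=\sum_{i,j}(-1)^iq^j\dim_{\mathbb F_2}\mathit{Kh}^{i,j}(L;\mathbb F_2)$ and $\widetilde V^{(r)}$ is the $r$-th derivative of the unnormalized Jones polynomial $\widetilde V$.
   Context: All links and diagrams are oriented. A singular link is an immersion of finitely many oriented circles in $S^3$ whose only singularities are finitely many transverse double points, considered up to ambient isotopy; a singular link diagram is a generic plane projection with ordinary (over/under) crossings and marked double points. Frobenius algebra. $A=\mathbb Z[x]/(x^2)$ with the usual multiplication $\mu$ and comultiplication $\Delta(1)=x\otimes1+1\otimes x$, $\Delta(x)=x\otimes x$; grading $\deg 1=1$, $\deg x=-1$. For a closed $1$-manifold $W$, $Z_A(W)=A^{\otimes\pi_0(W)}$; a saddle cobordism acts by $\mu$ if it merges two circles and by $\Delta$ if it splits one circle. Khovanov complex of an ordinary diagram $D$. Let $c(D)$ be the set of crossings. The $0$-smoothing of a crossing joins the two regions swept out when the overstrand is rotated counterclockwise until it meets the understrand; the $1$-smoothing is the other one (so the orientation-respecting smoothing is the $0$-smoothing at a positive crossing and the $1$-smoothing at a negative crossing). A state is a subset $s\subset c(D)$, and $D_s$ is the result of $1$-smoothing the crossings in $s$ and $0$-smoothing the others. Put $\overline C^{i,j}(D)=\bigoplus_{|s|=i}Z_A(D_s)^{j-i}$ (superscript on $Z_A$: homogeneous degree), with $d=\sum_{c}\pm\delta_c$,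 where $\delta_c:Z_A(D_s)\to Z_A(D_{s\cup\{c\}})$ for $c\notin s$ is the saddle map, $\delta_c=0$ for $c\in s$, and the signs are the standard ones making $d^2=0$ (irrelevant mod $2$). With $n_\pm$ the numbers of positive/negative crossings, $C^{i,j}(D)=\overline C^{i+n_-,\,j+2n_--n_+}(D)$ with the same differential. Genus-$1$ map. Let $D_-$ be an ordinary diagram with a negative crossing $b$ and let $D_+$ be obtained by changing $b$ to a positive crossing. The orientation-respecting smoothing at $b$ is the $1$-smoothing for $D_-$ and the $0$-smoothing for $D_+$. The genus-$1$ map $\widehat\Phi_b:C(D_-)\otimes\mathbb F_2\to C(D_+)\otimes\mathbb F_2$ is the chain map of bidegree $(0,0)$ that is zero on the summands for states $s\not\ni b$, and for $s\ni b$ sends $Z_A((D_-)_s)\otimes\mathbb F_2$ to $Z_A((D_+)_{s\setminus\{b\}})\otimes\mathbb F_2$ (the same $1$-manifold) by the composition of the saddle at $b$ followed by the reverse saddle: if the two strands at $b$ lie on different circles labelled $p,q$ this is $p\otimes q\mapsto\Delta(pq)$, and if they lie on the same circle labelled $p$ it is $p\mapsto\mu(\Delta(p))$; it is the identity on the other tensor factors. Singular diagrams. For a singular link diagram $D$ with set $c^\sharp(D)$ of double points and $S\subset c^\sharp(D)$, let $D_S$ be the ordinary diagram obtained by resolving the double points in $S$ to positive crossings and the others to negative crossings. The maps $\widehat\Phi_b:C(D_S)\otimes\mathbb F_2\to C(D_{S\cup\{b\}})\otimes\mathbb F_2$ ($b\notin S$) commute for distinct $b$. The Khovanov complex $C(D;\mathbb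 F_2)$ is the multiple mapping cone $$C^{i,j}(D;\mathbb F_2)=\bigoplus_{S\subset c^\sharp(D)}C^{\,i+|c^\sharp(D)\setminus S|,\,j}(D_S)\otimes\mathbb F_2,$$ whose differential is, on the $S$-summand, the sum of the differential of $C(D_S)\otimes\mathbb F_2$ and of all $\widehat\Phi_b$ with $b\in c^\sharp(D)\setminus S$ (signs are irrelevant in characteristic $2$). Put $\mathit{Kh}^{i,j}(D;\mathbb F_2)=H^i(C^{*,j}(D;\mathbb F_2))$; up to isomorphism it depends only on the singular link $L$ represented by $D$ and is written $\mathit{Kh}^{i,j}(L;\mathbb F_2)$. Unnormalized Jones polynomial. For an ordinary oriented link with diagram $D$, $\widetilde V=(-1)^{n_-}q^{n_+-2n_-}\langle D\rangle\in\mathbb Z[q,q^{-1}]$, where $\langle D\rangle=\sum_{s\subset c(D)}(-q)^{|s|}(q+q^{-1})^{|\pi_0(D_s)|}$. It is a link invariant. Derivatives. Let $\mathcal X_r$ be the set of ambient isotopy classes of singular links with exactly $r$ double points. For a link invariant $v:\mathcal X_0\to B$ with values in an abelian group $B$, the $r$-th derivative $v^{(r)}:\mathcal X_r\to B$ is defined inductively by $v^{(0)}=v$ and $v^{(r+1)}(L)=v^{(r)}(L_+)-v^{(r)}(L_-)$, where $L_+$, $L_-$ are obtained from $L$ by resolving one double point to a positive, respectively negative, crossing. *)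

(* Defs.v *)
From HB Require Import structures.
From mathcomp Require Import all_boot all_order all_algebra all_fingroup.
From mathcomp Require Import mathcomp_extra boolp classical_sets functions.
From mathcomp Require Import cardinality fsbigop.

Set Implicit Arguments.
Unset Strict Implicit.
Unset Printing Implicit Defensive.

Import Order.TTheory GRing.Theory Num.Theory.
Local Open Scope ring_scope.

(** * Singular link diagrams *)

(* The combinatorial map of a generic immersion of oriented circles in an
   oriented surface.  It records neither the nesting of the components of the
   image nor the point at infinity of the plane, which do not affect the link.
   At a vertex [v], draw the two transverse strands upwards:

      (true, true)    (true, false)            out
                 \    /
                   v
                 /    \
     (false, false)    (false, true)            in

   The strand [(v, false)] runs from south-west to north-east, and the strand
   [(v, true)] from south-east to north-west.  The edge leaving [v] along the
   strand [(v, b)] enters [w] along the strand [(w, c)], where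
   [(w, c) = follow (v, b)].  [ncircles] counts the components without vertices. *)
Record curve := Curve {
  vertex : finType;
  follow : {perm vertex * bool};
  ncircles : nat
}.

Section Curve.
Variable G : curve.

(* The half-edge [(v, o, b)] lies at [v] on the strand [(v, b)], on its outgoing
   side if [o = true] and on its incoming side if [o = false]. *)
Definition dart : finType := (vertex G * bool * bool)%type.

(* the other half of the same edge *)
Definition opp (d : dart) : dart :=
  let: (v, o, b) := d in
  if o then let wc := follow G (v, b) in (wc.1, false, wc.2)
  else let wc := (follow G)^-1%g (v, b) in (wc.1, true, wc.2).

(* the counterclockwise next half-edge at the same vertex *)
Definition turn (d : dart) : dart :=
  let: (v, o, b) := d in (v, o (+) b, ~~ b).

(* Euler's formula V + F = E + 2 C, which forces every component of the 4-valent
   graph to have genus 0; here E = 2 V, and the faces are the orbits of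
   [turn \o opp].  Nothing is required of the vertex-free circles. *)
Definition planar : bool :=
  (#|vertex G| + fcard (turn \o opp) predT ==
     #|vertex G|.*2 + (n_comp [rel d d' | (d' == opp d) || (d' == turn d)] predT).*2)%N.

(* The smoothings of the curve are indexed by the set [O] of vertices smoothed
   compatibly with the orientation; the other vertices are smoothed in the other
   way, joining the two incoming and the two outgoing half-edges. *)
Definition smooth (O : {set vertex G}) (d : dart) : dart :=
  let: (v, o, b) := d in (v, if v \in O then ~~ o else o, ~~ b).

Definition point : finType := (dart + 'I_(ncircles G))%type.

(* Adjacency of points along the smoothed 1-manifold: its components, the
   elements of pi_0, are the connected components of this graph. *)
Definition adj (O : {set vertex G}) : rel point := fun x y =>
  match x, y with
  | inl d, inl d' => (d' == opp d) || (d' == smooth O d)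
  | _, _ => false
  end.

Definition npi0 (O : {set vertex G}) : nat := n_comp (adj O) predT.

(** ** The Frobenius algebra A = Z[x]/(x^2) modulo 2, and saddle cobordisms *)

(* The Booleans index the basis of A: [false] is 1 and [true] is x.  The two
   functions below are the structure constants, all 0 or 1: [muA a b c] is the
   coefficient of c in a * b, and [DeltaA a b c] that of b (x) c in Delta(a). *)
Definition muA (a b c : bool) : bool := ~~ (a && b) && (c == a || b).
Definition DeltaA (a b c : bool) : bool := if a then b && c else b (+) c.

(* The basis of the tensor power of A over pi_0 given by the pure tensors of 1's
   and x's, i.e. functions pi_0 -> bool, seen as locally constant functions. *)
Definition labelling : Type := {ffun point -> bool}.
Definition labellings (O : {set vertex G}) : {set labelling} :=
  [set l : labelling | [forall x, forall y, adj O x y ==> (l x == l y)]].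

Definition degA (O : {set vertex G}) (l : labelling) : int :=
  \sum_(x | x \in roots (adj O)) (if l x then -1 else 1).

Definition toggle (O : {set vertex G}) (c : vertex G) : {set vertex G} :=
  if c \in O then O :\ c else c |: O.

(* Matrix coefficient from [l] to [l'] of the saddle at [c] from the smoothing
   [O] to the smoothing [toggle O c].  In both smoothings the two arcs at [c]
   are represented by the south-west half-edge and the north-east half-edge.
   The last case never occurs for a planar curve. *)
Definition saddle (O : {set vertex G}) (c : vertex G) (l l' : labelling) : 'F_2 :=
  let p : point := inl (c, false, false) in
  let q : point := inl (c, true, false) in
  let joined := connect (adj O) p q in
  let joined' := connect (adj (toggle O c)) p q in
  let far := [pred x | ~~ connect (adj O) p x && ~~ connect (adj O) q x] in
  if ~~ [forall x, far x ==> (l x == l' x)] then 0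
  else if ~~ joined && joined' then (muA (l p) (l q) (l' p))%:R
  else if joined && ~~ joined' then (DeltaA (l p) (l' p) (l' q))%:R
  else 0.

End Curve.

Record sdiagram := SDiagram {
  curve_of :> curve;
  (* [Some true]: positive crossing, with overstrand [(v, false)];
     [Some false]: negative crossing, with overstrand [(v, true)];
     [None]: double point. *)
  mark : {ffun vertex curve_of -> option bool};
  planar_curve_of : planar curve_of
}.

Section Diagram.
Variable D : sdiagram.

Definition npos : nat := #|[set v | mark D v == Some true]|.
Definition nneg : nat := #|[set v | mark D v == Some false]|.

(* the set of double points *)
Definition dblpts : {set vertex D} := [set v | mark D v == None].

Definition with_mark (m : {ffun vertex D -> option bool}) : sdiagram :=
  SDiagram m (planar_curve_of D).

(* resolution of the single double point [b], to a positive crossing if [e] *)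
Definition resolve1 (b : vertex D) (e : bool) : sdiagram :=
  with_mark [ffun v => if v == b then Some e else mark D v].

(* resolution of all double points: D_S *)
Definition resolve (S : {set vertex D}) : sdiagram :=
  with_mark [ffun v => if v \in dblpts then Some (v \in S) else mark D v].

End Diagram.

(** * The Khovanov complex of an ordinary diagram, modulo 2 *)

(* Below, [D] has no double points.  A generator of C(D) is a pair of a state,
   which is a set [s] of crossings, and a labelling of the components of D_s. *)
Section Ordinary.
Variable D : sdiagram.

Definition state : finType := ({set vertex D} * labelling D)%type.

(* The smoothing D_s: the orientation-respecting smoothing is the 0-smoothing at
   a positive crossing and the 1-smoothing at a negative one. *)
Definition smoothing (s : {set vertex D}) : {set vertex D} :=
  [set v | if mark D v == Some true then v \notin s else v \in s].

Definition is_generator (g : state) : bool := g.2 \in labellings (smoothing g.1).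

(* the bidegree (i, j) *)
Definition bideg (g : state) : int * int :=
  (#|g.1|%:Z - (nneg D)%:Z,
   degA (smoothing g.1) g.2 + #|g.1|%:Z - (nneg D)%:Z *+ 2 + (npos D)%:Z).

(* matrix coefficient of the differential from [g] to [h] *)
Definition diff_coef (g h : state) : 'F_2 :=
  \sum_(c | c \notin g.1)
    if h.1 == c |: g.1 then saddle (smoothing g.1) c g.2 h.2 else 0.

(* Matrix coefficient from [g], a generator of C(D) with [b] a negative crossing
   of [D], to [h], a generator of C(D_+), of the genus-1 map at [b]: the saddle
   at [b] followed by the reverse saddle. *)
Definition genus1_coef (b : vertex D) (g h : state) : 'F_2 :=
  let O := smoothing g.1 in
  if (b \in g.1) && (h.1 == g.1 :\ b) then
    \sum_(m in labellings (toggle O b))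
      saddle O b g.2 m * saddle (toggle O b) b m h.2
  else 0.

End Ordinary.

(** * The Khovanov homology of a singular diagram, modulo 2 *)

Section Singular.
Variable D : sdiagram.

(* the generators [(S, g)] of the multiple mapping cone, with [g] in C(D_S) *)
Definition cone_gen : finType :=
  {x : {set vertex D} * state D |
    (x.1 \subset dblpts D) && is_generator (D := resolve x.1) x.2}.

Definition chains : vectType 'F_2 := {ffun cone_gen -> ('F_2)^o}.

Definition cone_bideg (x : cone_gen) : int * int :=
  let ij := bideg (D := resolve (val x).1) (val x).2 in
  (ij.1 - #|dblpts D :\: (val x).1|%:Z, ij.2).

Definition cone_coef (x y : cone_gen) : 'F_2 :=
  let: (S0, g) := val x in
  let: (S1, h) := val y in
  (if S1 == S0 then diff_coef (D := resolve S0) g h else 0) +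
  \sum_(b in dblpts D :\: S0)
    if S1 == b |: S0 then genus1_coef (D := resolve S0) b g h else 0.

Definition differential : 'End(chains) :=
  linfun (fun f : chains => [ffun y => \sum_x f x * cone_coef x y] : chains).

Definition cone_basis (x : cone_gen) : chains := [ffun y => (y == x)%:R].

(* the homogeneous part C^{i,j}(D; F_2) *)
Definition chains_at (i j : int) : {vspace chains} :=
  <<[seq cone_basis x | x <- enum cone_gen & cone_bideg x == (i, j)]>>%VS.

(* The dimension of Kh^{i,j}(D; F_2): [U :\: V] is a complement of [U :&: V] in
   [U], hence isomorphic to the quotient U / (U :&: V). *)
Definition dimKh (i j : int) : nat :=
  \dim ((lker differential :&: chains_at i j)
        :\: (differential @: chains_at (i - 1) j))%VS.

End Singular.

(** * Graded Euler characteristic and unnormalized Jones polynomial *)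

(* Laurent polynomials in q over Z are taken in the fraction field of Z[q]. *)
Definition ratfun : fieldType := {fraction {poly int}}.
Definition q : ratfun := tofrac 'X.

Definition eulerKh (D : sdiagram) : ratfun :=
  \sum_(ij \in [set: int * int]%classic)
    (-1) ^ ij.1 * q ^ ij.2 * (dimKh D ij.1 ij.2)%:R.

(* for [D] without double points *)
Definition bracket (D : sdiagram) : ratfun :=
  \sum_(s : {set vertex D}) (- q) ^+ #|s| * (q + q^-1) ^+ npi0 (smoothing s).

Definition jones (D : sdiagram) : ratfun :=
  (-1) ^+ nneg D * q ^ ((npos D)%:Z - (nneg D)%:Z *+ 2) * bracket D.

(** * Derivatives *)

(* The r-th derivative, on diagrams with r double points.  The double point that
   is resolved first is arbitrary, by [derivativeS] below. *)
Fixpoint derivative (B : zmodType) (v : sdiagram -> B) (r : nat) (D : sdiagram)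
    {struct r} : B :=
  if r is r'.+1 then
    if [pick b in dblpts D] is Some b then
      derivative v r' (resolve1 b true) - derivative v r' (resolve1 b false)
    else 0
  else v D.

Lemma dblpts_resolve1 (D : sdiagram) (b : vertex D) (e : bool) :
  dblpts (resolve1 b e) = dblpts D :\ b.
Proof. by apply/setP => v; rewrite !inE ffunE; case: (_ == b). Qed.

Lemma resolve1C (D : sdiagram) (b c : vertex D) (e f : bool) : b != c ->
  resolve1 (D := resolve1 b e) c f = resolve1 (D := resolve1 c f) b e.
Proof.
move=> bc; rewrite /resolve1 /with_mark /=; congr SDiagram; apply/ffunP => v.
by rewrite !ffunE; case: (eqVneq v c) => // ->; rewrite eq_sym (negPf bc).
Qed.

Lemma derivativeS (B : zmodType) (v : sdiagram -> B) (r : nat) (D : sdiagram)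
    (b : vertex D) : #|dblpts D| = r.+1 -> b \in dblpts D ->
  derivative v r.+1 D =
    derivative v r (resolve1 b true) - derivative v r (resolve1 b false).
Proof.
have derS r' D' : derivative v r'.+1 D' =
    if [pick c in dblpts D'] is Some c then
      derivative v r' (resolve1 c true) - derivative v r' (resolve1 c false)
    else 0 by [].
elim: r D b => [|r IH] D b Dr bD; rewrite derS; case: pickP => [c cD|/(_ b)].
- have /cards1P[x Dx] : #|dblpts D| == 1%N by rewrite Dr.
  by move: bD cD; rewrite Dx !inE => /eqP-> /eqP->.
- by rewrite bD.
- have [<-//|cb] := eqVneq c b.
  have card_res x e : x \in dblpts D -> #|dblpts (resolve1 (D := D) x e)| = r.+1.
    by move=> xD; move: Dr; rewrite dblpts_resolve1 (cardsD1 x) xD => -[].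
  have step x y e : x != y -> x \in dblpts D -> y \in dblpts D ->
      derivative v r.+1 (resolve1 (D := D) x e) =
      derivative v r (resolve1 (D := resolve1 x e) y true) -
      derivative v r (resolve1 (D := resolve1 x e) y false).
    move=> xy xD yD; apply: IH; first exact: card_res.
    by rewrite dblpts_resolve1 !inE eq_sym xy; move: yD; rewrite inE.
  rewrite !(step c b) // !(step b c) ?(eq_sym b) // !(resolve1C _ _ cb).
  by rewrite !opprD !opprK addrACA.
- by rewrite bD.
Qed.

(* Hence [derivative v r D] is the value at the singular link [cl D] represented
   by [D] of the r-th derivative [w r] of a link invariant [w 0] which is
   computed by [v] on diagrams. *)
Lemma derivative_link (B : zmodType) (v : sdiagram -> B) (X : Type)
    (cl : sdiagram -> X) (w : nat -> X -> B) :
  (forall D, #|dblpts D| = 0%N -> w 0%N (cl D) = v D) ->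
  (forall r (D : sdiagram) (b : vertex D), #|dblpts D| = r.+1 -> b \in dblpts D ->
     w r.+1 (cl D) = w r (cl (resolve1 b true)) - w r (cl (resolve1 b false))) ->
  forall r D, #|dblpts D| = r -> w r (cl D) = derivative v r D.
Proof.
move=> w0 wS; elim=> [|r IH] D Dr; first exact: w0.
have /card_gt0P[b bD] : (0 < #|dblpts D|)%N by rewrite Dr.
have card_res e : #|dblpts (resolve1 (D := D) b e)| = r.
  by move: Dr; rewrite dblpts_resolve1 (cardsD1 b) bD => -[].
by rewrite (wS r D b) // (derivativeS v Dr bD) !IH.
Qed.

(* Main.v *)
From HB Require Import structures.
From mathcomp Require Import classical_sets fsbigop.
From mathcomp Require Import all_boot all_order all_algebra all_fingroup.
From mathcomp Require Import ring zify.
Require Import Defs.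

(** The graded Euler characteristic of a finite complex can be computed on
    chains, so the theorem amounts to two facts: the multiple mapping cone is a
    complex whose differential has bidegree (1, 0), and counting its generators
    gives the alternating sum of the polynomials of the resolutions D_S, which
    is the derivative.

    The counting is direct.  The labellings of a smoothing with k circles
    contribute (q + q^-1)^k ([sum_labellings]); the shift by the number of
    negatively resolved double points puts the sign (-1)^|c#(D) \ S| in front of
    the polynomial of D_S ([euler_cone]); and the derivative unfolds to the same
    signed sum over S ([derivative_resolve]).

    The main point is that the differential squares to zero
    ([cone_coef_square]).  Each of its components is a word of saddles: a
    crossing c gives the word c, and the genus-1 map at b gives the word b b.
    All cancellations modulo 2 thus follow from two statements: saddles at
    different vertices commute, and three successive saddles at one vertex
    compose to 0 ([run_catC], [run3]).

    To prove these, write A modulo 2 as the group algebra of Z/2 generated by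
    g = 1 + x.  The tensor power of A over the circles of a smoothing is then the
    quotient of the group algebra of F_2^points in which two points of one circle
    act equally.  If p and q are the two arcs at the vertex, a merging saddle is
    the quotient map, and a splitting saddle is the multiplication by g_p + g_q
    = x_p + x_q followed by the quotient map; when p and q stay on one circle in
    both smoothings, g_p + g_q is 0, as it should be.  So a composition of saddles
    is the multiplication by a product of such factors ([saddle_dual],
    [run_dual]), and it remains to compare factors.  Since (g_p + g_q)^2 = 0 the
    triple saddle vanishes, and the commutation of saddles at c and c' reduces to
    comparing, in the four smoothings at c and c', which of the two pairs of arcs
    are connected ([split_op_swap]).  That comparison uses one geometric input:
    at each vertex, at least one of the two smoothings joins the two arcs
    ([joined_toggle]), by a parity count of ends of arcs, and it is obtained from
    the other smoothing by gluing the circles at the vertex ([connect_toggle]). *)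

Set Implicit Arguments.
Unset Strict Implicit.
Unset Printing Implicit Defensive.

Import Order.TTheory GRing.Theory Num.Theory.
Local Open Scope ring_scope.

(** * Circles of the smoothings at a vertex *)

Lemma connect_min (T : finType) (e E : rel T) :
  reflexive E -> transitive E -> subrel e E -> subrel (connect e) E.
Proof.
move=> Er Et eE x y /connectP[s es ->] {y}.
elim: s x es => [|z s IH] x //= /andP[/eE xz /IH]; exact: Et.
Qed.

(** An involution without fixed points pairs off the elements. *)
Lemma even_card_involution (T : finType) (f : T -> T) (A : {set T}) :
  involutive f -> (forall x, f x != x) ->
  (forall x, x \in A -> f x \in A) -> ~~ odd #|A|.
Proof.
move=> fK fN; have [n] := ubnP #|A|; elim: n A => // n IH A ltAn fA.
have [->|[x xA]] := set_0Vmem A; first by rewrite cards0.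
have fxA : f x \in A :\ x by rewrite !inE fN fA.
move: ltAn; rewrite (cardsD1 x) xA (cardsD1 (f x)) fxA /= !add1n => ltAn.
rewrite negbK; apply: IH => [|y]; first exact: ltnW.
rewrite !inE => /and3P[yfx yx yA]; rewrite fA // andbT.
rewrite (inj_eq (inv_inj fK)) yx andTb; apply: contra yfx => /eqP <-.
by rewrite fK.
Qed.

Section Smoothings.
Variable G : curve.
Implicit Types (O : {set vertex G}) (c v : vertex G) (x y : point G).

Lemma in_toggle O c v : (v \in toggle O c) = (v \in O) (+) (v == c).
Proof.
rewrite /toggle; case: ifP => cO; rewrite !inE; case: eqVneq => [->|] //=.
- by rewrite cO.
- by rewrite addbF.
- by rewrite cO.
- by rewrite addbF.
Qed.

Lemma toggleK c : involutive (fun O => toggle O c).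
Proof. by move=> O; apply/setP => v; rewrite !in_toggle addbK. Qed.

Lemma toggleC O b c : toggle (toggle O b) c = toggle (toggle O c) b.
Proof. by apply/setP => v; rewrite !in_toggle addbAC. Qed.

Lemma oppK : involutive (@opp G).
Proof.
move=> [[v o] s]; case: o => /=; rewrite -surjective_pairing ?permK ?permKV //.
Qed.

Lemma opp_neq (d : dart G) : opp d != d.
Proof. by case: d => [[v []] s]; apply/eqP => /= -[]. Qed.

Lemma smoothK O : involutive (smooth O).
Proof.
by move=> [[v o] s] /=; rewrite negbK; case: (v \in O); rewrite ?negbK.
Qed.

Lemma smooth_neq O (d : dart G) : smooth O d != d.
Proof. by case: d => [[v o] []]; apply/eqP => /= -[]. Qed.

Lemma adj_sym O : symmetric (adj O).
Proof.
move=> [d|i] [d'|i'] //=.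
by rewrite !(eq_sym d) (inv_eq oppK) (inv_eq (smoothK O)) !(eq_sym d').
Qed.

Lemma adj_connect_sym O : connect_sym (adj O).
Proof. exact/sym_connect_sym/adj_sym. Qed.

(* South-west and north-east half-edges: they lie on different arcs in both
   smoothings at [c], and represent these arcs in [saddle]. *)
Definition sw c : point G := inl (c, false, false).
Definition ne c : point G := inl (c, true, false).
Definition joined O c : bool := connect (adj O) (sw c) (ne c).
(** The points on the circles through the vertex [c]. *)
Definition near O c x : bool :=
  connect (adj O) (sw c) x || connect (adj O) (ne c) x.

Lemma near_connect O c x y : connect (adj O) x y -> near O c x = near O c y.
Proof.
by move=> xy; rewrite /near !(same_connect_r (adj_connect_sym O) xy).
Qed.

Lemma near_sw O c : near O c (sw c). Proof. by rewrite /near connect0. Qed.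

Lemma near_ne O c : near O c (ne c).
Proof. by rewrite /near connect0 orbT. Qed.

Lemma near_vertex O c o s : near O c (inl (c, o, s)).
Proof.
case: s; last by case: o; [exact: near_ne | exact: near_sw].
rewrite (@near_connect _ _ _ (inl (smooth O (c, o, true)))); last first.
  by apply: connect1; rewrite /= eqxx orbT.
by rewrite /=; case: (if _ then _ else _); [exact: near_ne | exact: near_sw].
Qed.

Lemma adj_toggle O c x y :
  adj (toggle O c) x y -> adj O x y || near O c x && near O c y.
Proof.
case: x y => [[[v o] s]|i] [[[w o'] s']|i'] //=.
have [->|vc] := eqVneq v c.
  case/orP => [->//|]; move=> /eqP [-> _ _].
  by rewrite !near_vertex orbT.
by rewrite in_toggle (negPf vc) addbF => ->.
Qed.

(** If the new smoothing joins the two arcs at [c], its circles are the old ones,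
    with all those through [c] glued together: the edges that are exchanged
    connect points of these circles only. *)
Lemma connect_toggle O c x y : joined (toggle O c) c ->
  connect (adj (toggle O c)) x y =
    connect (adj O) x y || near O c x && near O c y.
Proof.
move=> J; have near_to z : near (toggle O c) c z ->
    connect (adj (toggle O c)) (sw c) z.
  by case/orP => // /(connect_trans J).
have sub : subrel (connect (adj O)) (connect (adj (toggle O c))).
  apply: connect_sub => u v; rewrite -{1}(toggleK c O) => /adj_toggle.
  case/orP => [/connect1//|/andP[/near_to nu /near_to nv]].
  by apply: connect_trans nv; rewrite adj_connect_sym.
have near_sub z : near O c z -> near (toggle O c) c z.
  by case/orP => /sub zz; rewrite /near zz ?orbT.
apply/idP/idP.
  apply: (@connect_min _ _ (fun x y => connect (adj O) x y ||
    near O c x && near O c y)) => [u|v u w|u v].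
  - by rewrite connect0.
  - case/orP => [uv|/andP[nu nv]] /orP[vw|/andP[nv' nw]].
    + by rewrite (connect_trans uv vw).
    + by rewrite (near_connect _ uv) nv' nw orbT.
    + by rewrite nu -(near_connect _ vw) nv orbT.
    + by rewrite nu nw orbT.
  - by case/adj_toggle/orP => [/connect1 ->|->]; rewrite ?orbT.
case/orP => [/sub//|/andP[/near_sub/near_to nx /near_sub/near_to]].
by apply: connect_trans; rewrite adj_connect_sym.
Qed.

(** Cut both arcs at [c].  The connected component of the south-west half-edge
    in the rest contains an even number of the four half-edges at [c], because
    its half-edges are paired by [opp], and those away from [c] also by the
    smoothing.  So it contains another half-edge at [c], and for each of the three
    possibilities one of the two smoothings at [c] connects it to the north-east
    half-edge. *)
Lemma joined_toggle O c : ~~ joined O c -> joined (toggle O c) c.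
Proof.
move=> nJ; apply/negPn/negP => nJ'.
pose cut x y := match x, y with
  | inl d, inl d' => (d' == opp d) || (d.1.1 != c) && (d' == smooth O d)
  | _, _ => false end.
have cut_adj O' : (forall v, v != c -> (v \in O') = (v \in O)) ->
    subrel (connect cut) (connect (adj O')).
  move=> eqO; apply: connect_sub => -[[[v o] s]|i] [d'|i'] //= /orP[/eqP->|].
    by apply: connect1; rewrite /= eqxx.
  case/andP => vc /eqP ->; apply: connect1; rewrite /= eqO // eqxx orbT //.
have cutO : subrel (connect cut) (connect (adj O)) by exact: cut_adj.
have cutO' : subrel (connect cut) (connect (adj (toggle O c))).
  by apply: cut_adj => v /negPf vc; rewrite in_toggle vc addbF.
pose X := [set d | connect cut (sw c) (inl d)].
have X_vertex d : d \in X -> d.1.1 = c -> d = (c, false, false).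
  rewrite inE; case: d => [[v o] s] cd /= vc; move: cd; rewrite {v}vc.
  (* the component lies on the circle of [sw c] in both smoothings, hence its
     half-edges are not on that of [ne c] *)
  have bridge O' : subrel (connect cut) (connect (adj O')) -> ~~ joined O' c ->
      connect cut (sw c) (inl (c, o, s)) ->
      ~~ connect (adj O') (inl (c, o, s)) (ne c).
    move=> sub nj /sub swd; apply: contra nj; exact: connect_trans.
  move=> cd; have := bridge _ cutO nJ cd; have := bridge _ cutO' nJ' cd.
  case: s o {cd bridge} => -[] //; last by rewrite connect0.
    have [cO|cO] := boolP (c \in O).
      by rewrite connect1 //= in_toggle eqxx cO /= eqxx orbT.
    by move=> _; rewrite connect1 //= (negPf cO) eqxx orbT.
  have [cO|cO] := boolP (c \in O).
    by move=> _; rewrite connect1 //= cO eqxx orbT.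
  by rewrite connect1 //= in_toggle eqxx (negPf cO) /= eqxx orbT.
have swX : (c, false, false) \in X by rewrite inE connect0.
have evX : ~~ odd #|X|.
  apply: (even_card_involution oppK opp_neq) => d; rewrite !inE => /connect_trans.
  by apply; apply: connect1; rewrite /= eqxx.
have : ~~ odd #|X :\ (c, false, false)|.
  apply: (even_card_involution (smoothK O) (smooth_neq O)) => d.
  rewrite !in_setD1 => /andP[dN dX].
  have dc : d.1.1 != c by apply: contra dN => /eqP /(X_vertex _ dX) ->.
  have sdX : smooth O d \in X.
    move: dX; rewrite !inE => /connect_trans; apply; apply: connect1.
    by rewrite /= dc eqxx orbT.
  rewrite sdX andbT; apply: contra dc => /eqP/(congr1 (fun d => d.1.1)) /= <-.
  by case: (d) => [[]].
by move: evX; rewrite (cardsD1 (c, false, false)) swX /= negbK => ->.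
Qed.

Lemma near_toggle O c : near (toggle O c) c =1 near O c.
Proof.
suff suf O' x : joined (toggle O' c) c -> near (toggle O' c) c x = near O' c x.
  move=> x; have [J|/joined_toggle/suf->//] := boolP (joined O c).
  by rewrite -{2}(toggleK c O) (suf (toggle O c)) ?toggleK.
move=> J; rewrite {1}/near !(connect_toggle _ _ J) near_sw near_ne /=.
by rewrite /near; do 2!case: connect.
Qed.

Lemma connect_far O c x y : ~~ near O c x ->
  connect (adj (toggle O c)) x y = connect (adj O) x y.
Proof.
move=> fx; have [J|/joined_toggle J] := boolP (joined O c).
  rewrite -{2}(toggleK c O) (@connect_toggle (toggle O c)) ?toggleK //.
  by rewrite near_toggle (negPf fx) orbF.
by rewrite connect_toggle // (negPf fx) orbF.
Qed.

End Smoothings.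

(** * Coefficient functionals of the saddle maps *)

Section Characters.
Variable G : curve.
Implicit Types (O : {set vertex G}) (c v : vertex G) (x y : point G).
Implicit Types (l m : labelling G) (t : {ffun point G -> 'F_2}).

Lemma F2_cases (a : 'F_2) : a = 0 \/ a = 1.
Proof. by case: a => [[|[|//]]] i; [left|right]; exact: val_inj. Qed.

Lemma F2_addxx (a : 'F_2) : a + a = 0.
Proof. by case: (F2_cases a) => ->; exact: val_inj. Qed.

Lemma labelling_connect O l x y :
  l \in labellings O -> connect (adj O) x y -> l x = l y.
Proof.
rewrite inE => /forallP lO xy; apply/eqP.
apply: (connect_min (E := fun x y => l x == l y) _ _ _ xy) => [u|v u w|u v uv].
- exact: eqxx.
- by move=> /eqP ->.
- by have /forallP/(_ v) := lO u; rewrite uv.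
Qed.

Lemma labellingP O l :
  (forall x y, connect (adj O) x y -> l x = l y) -> l \in labellings O.
Proof.
move=> lO; rewrite inE; apply/forallP => x; apply/forallP => y.
by apply/implyP => /connect1/lO ->.
Qed.

(** A function [t] on points stands for the product g^t of the generators g_x
    with exponents [t x].  In the tensor power of A, the factor of g^t on a circle
    is g to the power of the mass of [t] on that circle. *)
Definition mass O t x : 'F_2 := \sum_(y | connect (adj O) x y) t y.

Definition unit_mass x : {ffun point G -> 'F_2} := [ffun y => (y == x)%:R].

Lemma massD O t u x : mass O (t + u) x = mass O t x + mass O u x.
Proof. by rewrite -big_split; apply: eq_bigr => y _; rewrite !ffunE. Qed.

Lemma mass_unit O x y : mass O (unit_mass y) x = (connect (adj O) x y)%:R.
Proof.
rewrite /mass; under eq_bigr => z _ do rewrite ffunE.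
case: (boolP (connect _ x y)) => xy.
  rewrite (bigD1 y) //= eqxx big1 ?addr0 // => z /andP[_ /negPf ->] //.
by rewrite big1 // => z xz; case: eqVneq => // zy; rewrite -zy xz in xy.
Qed.

Lemma mass_connect O t x y : connect (adj O) x y -> mass O t x = mass O t y.
Proof.
move=> xy; apply: eq_bigl => z.
by rewrite (same_connect (adj_connect_sym O) xy).
Qed.

Lemma mass_far O c t x : ~~ near O c x -> mass (toggle O c) t x = mass O t x.
Proof. by move=> fx; apply: eq_bigl => y; rewrite connect_far. Qed.

Lemma mass_merge O c t : ~~ joined O c ->
  mass (toggle O c) t (sw c) = mass O t (sw c) + mass O t (ne c).
Proof.
move=> nJ; have J := joined_toggle nJ.
rewrite /mass (bigID (connect (adj O) (sw c))) /=; congr (_ + _).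
  apply: eq_bigl => x; rewrite connect_toggle // near_sw /= /near.
  by case: connect; rewrite ?andbT ?andbF.
apply: eq_bigl => x; rewrite connect_toggle // near_sw /= /near.
case: (boolP (connect _ (sw c) x)) => /= swx; last by rewrite andbT.
symmetry; apply: contraNF nJ => nex; apply: connect_trans swx _.
by rewrite adj_connect_sym.
Qed.

(** The coefficient of the pure tensor [l] in g^t: since g^m = 1 + m x for m in
    F_2, it is the product of the masses over the circles labelled by x, that is
    1 if these masses are all 1. *)
Definition dual O l t : 'F_2 := [forall x, l x ==> (mass O t x == 1)]%:R.

Lemma dual_unit O l t x y : connect (adj O) x y ->
  dual O l (t + unit_mass x) = dual O l (t + unit_mass y).
Proof.
move=> xy; congr (_%:R); congr (nat_of_bool _); apply: eq_forallb => z.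
by rewrite !massD !mass_unit (same_connect_r (adj_connect_sym O) xy).
Qed.

(** The part of [dual] that comes from the circles not passing through [c]. *)
Definition far_dual O c l t : bool :=
  [forall x, ~~ near O c x ==> (l x ==> (mass O t x == 1))].

Lemma dual_near O c l t : l \in labellings O ->
  dual O l t = (far_dual O c l t)%:R * (if l (sw c) then mass O t (sw c) else 1)
                 * (if l (ne c) then mass O t (ne c) else 1).
Proof.
move=> lO; have wtE (e : bool) (a : 'F_2) :
    (if e then a else 1) = (e ==> (a == 1))%:R.
  by case: e (F2_cases a) => // -[] ->.
rewrite !wtE -!natrM !mulnb; congr (_%:R); congr (nat_of_bool _).
apply/forallP/andP => [H|[/andP[/forallP F Hs] Hn] x].
  by split; [apply/andP; split|] => //; apply/forallP => x; apply/implyP.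
have [/orP[xs|xn]|fx] := boolP (near O c x); last by have := F x; rewrite fx.
- by rewrite -(labelling_connect lO xs) -(mass_connect _ xs).
- by rewrite -(labelling_connect lO xn) -(mass_connect _ xn).
Qed.

(** The labellings that are compatible with a given labelling of the other
    smoothing are determined by the labels of the two arcs at [c]. *)
Definition patch O c (a b : bool) l : labelling G :=
  [ffun x => if connect (adj O) (sw c) x then a
             else if connect (adj O) (ne c) x then b else l x].

Definition agree_far O c l l' : bool :=
  [forall x, ~~ near O c x ==> (l x == l' x)].

Lemma patch_labelling O c (a b : bool) l :
  l \in labellings (toggle O c) -> patch O c a b l \in labellings O.
Proof.
move=> lO'; apply: labellingP => x y xy; rewrite !ffunE.
rewrite !(same_connect_r (adj_connect_sym O) xy).
case: ifP => // swy; case: ifP => // ney; apply: labelling_connect lO' _.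
by rewrite connect_far // (near_connect _ xy) /near swy ney.
Qed.

Lemma sum_agree_far O c l' (F : labelling G -> 'F_2) :
  l' \in labellings (toggle O c) ->
  \sum_(l in labellings O | agree_far O c l l') F l =
  \sum_(ab : bool * bool | joined O c ==> (ab.1 == ab.2))
     F (patch O c ab.1 ab.2 l').
Proof.
move=> lO'; pose h (ab : bool * bool) := patch O c ab.1 ab.2 l'.
have h_far ab : agree_far O c (h ab) l'.
  apply/forallP => x; apply/implyP; rewrite negb_or => /andP[/negPf s /negPf n].
  by rewrite ffunE s n.
rewrite (reindex_onto h (fun l => (l (sw c), l (ne c)))) /=.
  apply: eq_bigl => -[a b]; rewrite h_far patch_labelling //= !ffunE !connect0.
  by rewrite -/(joined O c) xpair_eqE eqxx /=; case: joined; rewrite ?eqxx.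
move=> l /andP[lO /forallP lf]; apply/ffunP => x; rewrite ffunE /=.
case: ifP => [/(labelling_connect lO)//|s].
case: ifP => [/(labelling_connect lO)//|n].
by have := lf x; rewrite /near s n /= => /eqP.
Qed.

Lemma saddleE O c l l' : saddle O c l l' =
  if ~~ agree_far O c l l' then 0
  else if ~~ joined O c then (muA (l (sw c)) (l (ne c)) (l' (sw c)))%:R
  else if ~~ joined (toggle O c) c
    then (DeltaA (l (sw c)) (l' (sw c)) (l' (ne c)))%:R
  else 0.
Proof.
rewrite /saddle; set A := [forall x, _]; have -> : A = agree_far O c l l'.
  by apply: eq_forallb => x; rewrite /= /near negb_or.
rewrite -/(sw c) -/(ne c) -/(joined O c) -/(joined (toggle O c) c).
by have [J|/joined_toggle ->//] := boolP (joined O c).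
Qed.

Lemma far_dual_patch O c (a b : bool) l t :
  far_dual O c (patch O c a b l) t = far_dual (toggle O c) c l t.
Proof.
apply: eq_forallb => x; rewrite near_toggle; case: (boolP (near O c x)) => //= fx.
rewrite mass_far // ffunE.
by move: fx; rewrite negb_or => /andP[/negPf -> /negPf ->].
Qed.

Lemma far_dual_unit O c l t x : near O c x ->
  far_dual O c l (t + unit_mass x) = far_dual O c l t.
Proof.
move=> nx; apply: eq_forallb => y; case: (boolP (near O c y)) => //= fy.
rewrite massD mass_unit; case: (boolP (connect _ y x)) => [yx|]; rewrite ?addr0 //.
by rewrite (near_connect c yx) nx in fy.
Qed.

(** A merging saddle maps g^t to g^t and a splitting one maps it to
    (g_p + g_q) g^t; this is the transposed statement, on coefficients.  When the
    two arcs are on one circle in both smoothings both sides vanish, the right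
    hand side because g_p = g_q on that circle. *)
Lemma saddle_dual O c l' t : l' \in labellings (toggle O c) ->
  \sum_(l in labellings O) saddle O c l l' * dual O l t =
  if joined O c then dual (toggle O c) l' (t + unit_mass (sw c))
                     + dual (toggle O c) l' (t + unit_mass (ne c))
  else dual (toggle O c) l' t.
Proof.
move=> lO'; rewrite (bigID (fun l => agree_far O c l l')) /=.
rewrite [X in _ + X]big1 ?addr0; last first.
  by move=> l /andP[_ nf]; rewrite saddleE nf mul0r.
rewrite (sum_agree_far (fun l => saddle O c l l' * dual O l t) lO') /=.
have [/andP[J J']|nJJ'] := boolP (joined O c && joined (toggle O c) c).
  rewrite J (dual_unit _ _ J') F2_addxx big1 // => -[a b] _.
  by rewrite saddleE J J' /= if_same mul0r.
pose K (a b : bool) : 'F_2 :=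
    (if ~~ joined O c then (muA a b (l' (sw c)))%:R
     else (DeltaA a (l' (sw c)) (l' (ne c)))%:R) *
    ((far_dual (toggle O c) c l' t)%:R * (if a then mass O t (sw c) else 1)
       * (if b then mass O t (ne c) else 1)).
rewrite (eq_bigr (fun ab => K ab.1 ab.2)); last first.
  move=> [a b] /= ab.
  rewrite (@dual_near O c) ?patch_labelling // far_dual_patch saddleE.
  have -> : agree_far O c (patch O c a b l') l'.
    apply/forallP => x; apply/implyP.
    by rewrite negb_or ffunE => /andP[/negPf -> /negPf ->].
  have -> : patch O c a b l' (sw c) = a by rewrite ffunE connect0.
  have -> : patch O c a b l' (ne c) = b.
    by rewrite ffunE connect0 -/(joined O c); case: joined ab => //= /eqP.
  rewrite /K /=; congr (_ * _); case: ifP => // /negbFE J.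
  by move: nJJ'; rewrite J /= => ->.
rewrite -(pair_big_dep xpredT (fun a b => joined O c ==> (a == b)) K) /=.
under eq_bigr => a _ do rewrite big_mkcond big_bool.
rewrite big_bool /= {}/K.
rewrite !(@dual_near (toggle O c) c) // ?far_dual_unit ?near_sw ?near_ne //.
rewrite !massD !mass_unit !connect0.
rewrite (adj_connect_sym _ (ne c)) -/(joined (toggle O c) c).
have [J|nJ] /= := boolP (joined O c).
  have nJ' : ~~ joined (toggle O c) c by move: nJJ'; rewrite J.
  have <- := mass_connect t J; rewrite (negPf nJ').
  have := mass_merge t nJ'; rewrite toggleK => ->.
  case: (far_dual _ _ _ _); rewrite ?mul0r ?mulr0 ?addr0 ?mul1r //=.
  move: (mass _ t (sw c)) (mass _ t (ne c)) => a b.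
  by case: (F2_cases a) (F2_cases b) (l' (sw c)) (l' (ne c)) => -> [] -> [] [];
    apply/eqP.
have J' := joined_toggle nJ; have <- := mass_connect t J'; rewrite mass_merge //.
have <- := labelling_connect lO' J'.
case: (far_dual _ _ _ _); rewrite ?mul0r ?mulr0 ?addr0 ?mul1r //=.
move: (mass _ t (sw c)) (mass _ t (ne c)) => a b.
by case: (F2_cases a) (F2_cases b) (l' (sw c)) => -> [] -> []; apply/eqP.
Qed.
End Characters.

(** * Compositions of saddles *)

Section Commutation.
Variable G : curve.
Implicit Types (O : {set vertex G}) (c v : vertex G) (x y : point G).
Implicit Types (l m : labelling G) (t : {ffun point G -> 'F_2}).
Implicit Types (w : seq (vertex G)) (h : {ffun point G -> 'F_2} -> 'F_2).

(** Spreads a labelling back to an exponent, with one point for each circle. *)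
Definition root_mass O l : {ffun point G -> 'F_2} :=
  [ffun x => ((x \in roots (adj O)) && l x)%:R].

Lemma mass_root_mass O l x :
  l \in labellings O -> mass O (root_mass O l) x = (l x)%:R.
Proof.
move=> lO; have sC := adj_connect_sym O; pose r := fingraph.root (adj O) x.
have xr : connect (adj O) x r := connect_root _ _.
have rr : r \in roots (adj O) by exact: roots_root.
rewrite /mass (bigD1 r) //= ffunE rr -(labelling_connect lO xr).
rewrite big1 ?addr0 // => y /andP[xy yr]; rewrite ffunE.
case: (boolP (y \in roots _)) => //= /eqP ry; case/eqP: yr.
by rewrite /r (fingraph.rootP sC xy).
Qed.

(** The exponents [root_mass O k] evaluate [dual O l] to 1 exactly when every
    circle labelled by x in [l] is so in [k].  This is a triangular system, solved
    by induction on the number of points labelled by x in [k]. *)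
Lemma dual_free O (a : labelling G -> 'F_2) :
  (forall t, \sum_(l in labellings O) a l * dual O l t = 0) ->
  forall l, l \in labellings O -> a l = 0.
Proof.
move=> a0 k; have [n] := ubnP #|[set x | k x]|; elim: n k => // n IH k kn kO.
have dualE l : dual O l (root_mass O k) = [forall x, l x ==> k x]%:R.
  congr (nat_of_bool _)%:R; apply: eq_forallb => x.
  by rewrite mass_root_mass //; case: (l x) (k x) => -[].
rewrite -(a0 (root_mass O k)) (bigD1 k) //= dualE.
have -> : [forall x, k x ==> k x] by apply/forallP => x; exact: implybb.
rewrite mulr1 big1 ?addr0 // => l /andP[lO lk]; rewrite dualE.
case: (boolP [forall x, _]) => [/forallP sub|_]; last by rewrite mulr0.
rewrite IH ?mul0r //; rewrite ltnS in kn; apply: leq_trans kn.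
apply: proper_card; rewrite finset.properEneq; apply/andP; split.
  apply: contra lk => /eqP/setP eqlk; apply/eqP/ffunP => x.
  by have := eqlk x; rewrite !inE.
by apply/subsetP => x; rewrite !inE; apply/implyP.
Qed.

(** The transpose of the multiplication by g_p + g_q, or by 1 if not [J]. *)
Definition split_op (J : bool) c h t : 'F_2 :=
  if J then h (t + unit_mass (sw c)) + h (t + unit_mass (ne c)) else h t.

Arguments split_op : simpl never.

Lemma split_opC (J J' : bool) c c' h t :
  split_op J c (split_op J' c' h) t = split_op J' c' (split_op J c h) t.
Proof.
rewrite /split_op; case: J J' => -[] //.
by rewrite addrACA; congr (_ + _ + (_ + _)); congr h; rewrite addrAC.
Qed.

Lemma split_op_joined O (J : bool) c l t :
  joined O c -> J -> split_op J c (dual O l) t = 0.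
Proof. by move=> jO ->; rewrite /split_op (dual_unit _ _ jO) F2_addxx. Qed.

Lemma split_op0 (J : bool) c h t : (forall u, h u = 0) -> split_op J c h t = 0.
Proof. by move=> h0; rewrite /split_op !h0 addr0 if_same. Qed.

(** (g_p + g_q)^2 = 0 in characteristic 2. *)
Lemma split_op_idem c h t : split_op true c (split_op true c h) t = 0.
Proof.
have addtt u : t + u + u = t.
  by apply/ffunP => x; rewrite !ffunE -addrA F2_addxx addr0.
by rewrite /split_op !addtt (addrAC t (unit_mass (ne c))) [X in _ + X]addrC F2_addxx.
Qed.

Lemma connect_toggle_sub O c x y : joined (toggle O c) c ->
  connect (adj O) x y -> connect (adj (toggle O c)) x y.
Proof. by move=> J xy; rewrite connect_toggle // xy. Qed.

(** If two circles through [c] become connected, then so do the two arcs at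
    [c]. *)
Lemma near_separates O O' c x y :
  near O c x -> near O c y -> ~~ connect (adj O) x y ->
  subrel (connect (adj O)) (connect (adj O')) -> connect (adj O') x y ->
  joined O' c.
Proof.
move=> nx ny nxy sub xy; have sC := adj_connect_sym.
case/orP: nx => nx; case/orP: ny => ny; rewrite /joined.
- by case/negP: nxy; apply: connect_trans ny; rewrite sC.
- by apply: (connect_trans (sub _ _ nx)); rewrite (connect_trans xy) // sC sub.
- rewrite sC; apply: (connect_trans (sub _ _ nx)).
  by rewrite (connect_trans xy) // sC sub.
- by case/negP: nxy; apply: connect_trans ny; rewrite sC.
Qed.

(** Where the factors differ, suppose it is at [c].  If the
    surgery at [c'] disconnects the arcs at [c], it splits their circle in two,
    which the surgery at [c] reconnects; both products then contain a factor that
    vanishes in the last smoothing.  If it connects them, then both surgeries merge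
    the same two circles; the factors to be compared are g_p + g_q at [c] and at
    [c'], and they are either both 0, or equal, as the arcs at [c] and at [c'] lie
    on the same two circles of the last smoothing. *)
Lemma split_op_swap O c c' l t :
  split_op (joined O c) c
    (split_op (joined (toggle O c) c') c' (dual (toggle (toggle O c) c') l)) t =
  split_op (joined O c') c'
    (split_op (joined (toggle O c') c) c (dual (toggle (toggle O c) c') l)) t.
Proof.
wlog suff key : c c' / joined O c != joined (toggle O c') c ->
  split_op (joined O c) c
    (split_op (joined (toggle O c) c') c' (dual (toggle (toggle O c) c') l)) t =
  split_op (joined O c') c'
    (split_op (joined (toggle O c') c) c (dual (toggle (toggle O c) c') l)) t.
  have [eqc|/key//] := eqVneq (joined O c) (joined (toggle O c') c).
  have [eqc'|/key] := eqVneq (joined O c') (joined (toggle O c) c').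
    by rewrite -eqc -eqc' split_opC.
  by rewrite toggleC => ->.
set O01 := toggle O c'; set O10 := toggle O c; set O11 := toggle O10 c'.
have O11E : O11 = toggle O01 c by rewrite /O11 toggleC.
have O00E : O = toggle O01 c' by rewrite toggleK.
have O01E : O01 = toggle O11 c by rewrite O11E toggleK.
have [J00 J01|J00] := boolP (joined O c).
  have {}J01 : ~~ joined O01 c by case: joined J01.
  have J11 : joined O11 c by rewrite O11E joined_toggle.
  have J00' : joined O c'.
    apply: contraR J01 => /joined_toggle J01'.
    exact: connect_toggle_sub J01' J00.
  have : connect (adj O) (sw c) (ne c) := J00.
  rewrite {1}O00E connect_toggle -?O00E //.
  rewrite -/(joined O01 c) (negPf J01) /= => /andP[nsw nne].
  have J11' : joined O11 c'.
    apply: (near_separates nsw nne J01 _ J11) => x y.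
    by rewrite O11E; apply: connect_toggle_sub; rewrite -O11E.
  have z u : split_op true c (dual O11 l) u = 0 by rewrite split_op_joined.
  by rewrite split_opC (split_op0 _ _ _ z) split_op_joined.
case J01: (joined O01 c) => // _.
have J00' : ~~ joined O c'.
  apply: contra J00 => J00'; rewrite /joined O00E.
  by apply: connect_toggle_sub; rewrite -?O00E.
have J01' := joined_toggle J00'; have J10 := joined_toggle J00.
have : connect (adj O01) (sw c) (ne c) := J01; rewrite connect_toggle //.
rewrite -/(joined O c) (negPf J00) /= => /andP[nsw nne].
have J10' : joined O10 c'.
  apply: (near_separates nsw nne J00 _ J10) => x y; exact: connect_toggle_sub.
rewrite (negPf J00') J10' {1 3}/split_op.
have [J11|J11] := boolP (joined O11 c).
  have J11' : joined O11 c'.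
    by rewrite /joined O11E; apply: connect_toggle_sub; rewrite -?O11E.
  by rewrite !split_op_joined.
have [J11'|J11'] := boolP (joined O11 c').
  by case/negP: J11; apply: connect_toggle_sub.
have : connect (adj O01) (sw c') (ne c') := J01'.
rewrite O01E connect_toggle -?O01E //.
rewrite -/(joined O11 c') (negPf J11') /split_op /= => /andP[].
case/orP => sw' /orP[] ne'.
- case/negP: J11'; apply: connect_trans ne'; by rewrite adj_connect_sym.
- by rewrite (dual_unit _ _ sw') (dual_unit _ _ ne').
- by rewrite (dual_unit _ _ sw') (dual_unit _ _ ne') addrC.
- case/negP: J11'; apply: connect_trans ne'; by rewrite adj_connect_sym.
Qed.

Definition toggles O w := foldl (@toggle G) O w.

(** The matrix of the composition of the saddles at the letters of [w]. *)
Fixpoint run O w l l' : 'F_2 :=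
  if w is c :: w' then
    \sum_(m in labellings (toggle O c)) saddle O c l m * run (toggle O c) w' m l'
  else (l == l')%:R.

Fixpoint split_ops O w h t : 'F_2 :=
  if w is c :: w' then split_op (joined O c) c (split_ops (toggle O c) w' h) t
  else h t.

(** [saddle_dual], iterated along a word. *)
Lemma run_dual O w l' t : l' \in labellings (toggles O w) ->
  \sum_(l in labellings O) run O w l l' * dual O l t =
  split_ops O w (dual (toggles O w) l') t.
Proof.
elim: w O t => [|c w IH] O t lO /=.
  rewrite (bigD1 l') //= eqxx mul1r big1 ?addr0 // => l /andP[_ /negPf ->].
  by rewrite mul0r.
under eq_bigr => l _ do rewrite big_distrl /=.
rewrite exchange_big /= (eq_bigr (fun m => run (toggle O c) w m l' *
  split_op (joined O c) c (dual (toggle O c) m) t)) => [|m mO]; last first.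
  rewrite /split_op -saddle_dual // big_distrr /=; apply: eq_bigr => l _.
  by rewrite mulrCA mulrA.
rewrite /split_op -!IH //; case: joined => //.
by rewrite -big_split /=; apply: eq_bigr => m _; rewrite mulrDr.
Qed.

(** As the functionals [dual] are independent, a composition is determined by
    its action on them. *)
Lemma run_eq O w w' l l' : toggles O w = toggles O w' ->
  l \in labellings O -> l' \in labellings (toggles O w) ->
  (forall t, split_ops O w (dual (toggles O w) l') t =
             split_ops O w' (dual (toggles O w) l') t) ->
  run O w l l' = run O w' l l'.
Proof.
move=> eqT lO lO' eqS; apply/eqP; rewrite -subr_eq0; apply/eqP.
apply: (dual_free (a := fun l => run O w l l' - run O w' l l')) lO => t.
under eq_bigr => m _ do rewrite mulrBl.
rewrite sumrB !run_dual -?eqT // eqS subrr //.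
Qed.

Lemma in_toggles O w v : (v \in toggles O w) = (v \in O) (+) odd (count_mem v w).
Proof.
elim: w O => [|c w IH] O /=; first by rewrite addbF.
by rewrite IH in_toggle oddD oddb addbA (eq_sym v).
Qed.

Lemma toggles_perm O w w' : perm_eq w w' -> toggles O w = toggles O w'.
Proof. by move/seq.permP=> eqw; apply/setP => v; rewrite !in_toggles eqw. Qed.

Lemma run_cat O w w' l l' : l \in labellings O ->
  run O (w ++ w') l l' =
  \sum_(m in labellings (toggles O w)) run O w l m * run (toggles O w) w' m l'.
Proof.
elim: w O l => [|c w IH] O l lO /=.
  rewrite (bigD1 l) //= eqxx mul1r big1 ?addr0 // => m /andP[_].
  by rewrite eq_sym => /negPf ->; rewrite mul0r.
under eq_bigr => m mO do rewrite IH // big_distrr /=.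
rewrite exchange_big /=; apply: eq_bigr => m _.
by rewrite big_distrl /=; apply: eq_bigr => k _; rewrite mulrA.
Qed.

Lemma run_swap O c c' w l l' : l \in labellings O ->
  run O [:: c, c' & w] l l' = run O [:: c', c & w] l l'.
Proof.
move=> lO; rewrite -[[:: c, c' & w]]/([:: c; c'] ++ w) -[[:: c', c & w]]/([:: c'; c] ++ w).
rewrite !run_cat //.
have perm_cc' : perm_eq [:: c; c'] [:: c'; c] by exact/permPl/(perm_catC [:: c] [:: c']).
rewrite (toggles_perm _ perm_cc'); apply: eq_bigr => m mO; congr (_ * _).
apply: run_eq => [||| t] //; [exact: toggles_perm | |].
  by rewrite (toggles_perm _ perm_cc').
exact: split_op_swap.
Qed.

Lemma run_cons O c w l l' : run O (c :: w) l l' =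
  \sum_(m in labellings (toggle O c)) saddle O c l m * run (toggle O c) w m l'.
Proof. by []. Qed.

Lemma run_rot O c w l l' : l \in labellings O ->
  run O (c :: w) l l' = run O (rcons w c) l l'.
Proof.
elim: w O l => // c' w IH O l lO; rewrite run_swap //.
rewrite rcons_cons [LHS]run_cons [RHS]run_cons.
by apply: eq_bigr => m mO; rewrite IH.
Qed.

Lemma run_catC O w w' l l' : l \in labellings O ->
  run O (w ++ w') l l' = run O (w' ++ w) l l'.
Proof.
move=> lO; elim: w w' => [|c w IH] w'; first by rewrite cats0.
by rewrite run_rot // rcons_cat IH cat_rcons.
Qed.

(** At one of the three steps of [c c c] the two arcs are joined.  If it is so at
    the first step, then also at the third, and (g_p + g_q)^2 = 0; if it is so at
    the second step only, the last smoothing joins them and g_p + g_q = 0 there. *)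
Lemma run3 O c l l' : l \in labellings O -> l' \in labellings (toggle O c) ->
  run O [:: c; c; c] l l' = 0.
Proof.
move=> lO lO'; have toggles3 : toggles O [:: c; c; c] = toggle O c.
  by rewrite /toggles /= toggleK.
apply: (dual_free (a := fun l => run O [:: c; c; c] l l')) lO => t.
rewrite run_dual toggles3 //= toggleK.
have [J|/joined_toggle J'] := boolP (joined O c).
  rewrite (split_opC true) split_op0 // => u; exact: split_op_idem.
rewrite split_op0 // => u; rewrite split_opC split_op0 // => v.
by rewrite split_op_joined.
Qed.
End Commutation.

(** * The differential of the mapping cone *)

Section ConeMoves.
Variable D : sdiagram.
Implicit Types (S s : {set vertex D}) (c v : vertex D) (l m : labelling D).
Definition cone_index : finType := ({set vertex D} * {set vertex D})%type.

Implicit Types (x y z : cone_gen D) (k : vertex D * bool) (p : cone_index).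

(** An index [p = (S, s)] is a resolution of the double points with a state. *)
Definition smoothing_at p : {set vertex D} := smoothing (D := resolve p.1) p.2.

Lemma in_smoothing_at p v : (v \in smoothing_at p) =
  (if v \in dblpts D then v \in p.1 else mark D v == Some true) (+) (v \in p.2).
Proof.
rewrite inE /= ffunE; case: (v \in dblpts D); first by case: (v \in p.1).
by case: (mark D v == Some true).
Qed.

(** The components of the differential.  The move [(c, false)] is the component
    of the differential of C(D_S) at the crossing [c], and [(b, true)] is the
    genus-1 map at the double point [b]; their matrices are those of the words
    [c] and [b b]. *)
Definition move_ok k p : bool :=
  if k.2 then (k.1 \in dblpts D :\: p.1) && (k.1 \in p.2) else k.1 \notin p.2.

Definition move k p : cone_index :=
  if k.2 then (k.1 |: p.1, p.2 :\ k.1) else (p.1, k.1 |: p.2).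

Definition move_word k : seq (vertex D) := if k.2 then [:: k.1; k.1] else [:: k.1].

Lemma smoothing_move k p : move_ok k p ->
  smoothing_at (move k p) = toggles (smoothing_at p) (move_word k).
Proof.
case: k p => c g [S s]; rewrite /move_ok /move /move_word /= => ok.
apply/setP => v; rewrite in_toggles !in_smoothing_at; case: g ok => /=.
  rewrite !inE => /andP[/andP[cS cd] cs].
  rewrite addn0 addnn odd_double addbF; case: (eqVneq v c) => [->|] //=.
  by rewrite cd cs (negPf cS).
move=> cs; rewrite !inE addn0 oddb (eq_sym c).
by case: (eqVneq v c) => [->|]; rewrite /= ?addbF // (negPf cs) addbF.
Qed.

Lemma move_sub k p : move_ok k p -> p.1 \subset dblpts D ->
  (move k p).1 \subset dblpts D.
Proof.
case: k p => c [] [S s] //=; rewrite /move_ok /move /= => /andP[cdS _] Sd.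
by rewrite subUset sub1set Sd andbT; case/setDP: cdS.
Qed.

Lemma move_okC k k' p : k.1 != k'.1 ->
  move_ok k p && move_ok k' (move k p) = move_ok k' p && move_ok k (move k' p).
Proof.
case: k k' p => c g [c' g'] [S s]; rewrite /move_ok /move /= => cc'.
by case: g g' => -[]; rewrite /= ?inE ?(eq_sym c') ?(negPf cc') /=;
  do ?case: (_ \in _); do ?case: (_ == _).
Qed.

Lemma moveC k k' p : k.1 != k'.1 -> move k' (move k p) = move k (move k' p).
Proof.
case: k k' p => c g [c' g'] [S s] /= cc'; rewrite /move /=.
case: g g' => -[] /=; congr pair; apply/setP => v; rewrite !inE;
  by case: (eqVneq v c) cc' => [->|_ _]; case: eqVneq.
Qed.

Definition gen_index (x : cone_gen D) : cone_index := ((val x).1, (val x).2.1).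
Definition gen_label (x : cone_gen D) : labelling D := (val x).2.2.

Lemma gen_labelP x : gen_label x \in labellings (smoothing_at (gen_index x)).
Proof. by case/andP: (valP x). Qed.

Lemma gen_sub x : (gen_index x).1 \subset dblpts D.
Proof. by case/andP: (valP x). Qed.

(** Sums over the generators are sums over all indices and labellings, so that a move
    can be summed over its target index first. *)
Lemma big_cone_gen (R : nmodType) (F : cone_index -> labelling D -> R) :
  \sum_x F (gen_index x) (gen_label x) =
  \sum_(p : cone_index | p.1 \subset dblpts D) \sum_(l in labellings (smoothing_at p)) F p l.
Proof.
rewrite pair_big_dep /=.
pose h (u : cone_index * labelling D) :
  {set vertex D} * state D := (u.1.1, (u.1.2, u.2)).
rewrite (reindex_omap (fun x : cone_gen D => (gen_index x, gen_label x))
  (fun u => insub (h u))) /=.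
  apply: eq_bigl => x; rewrite gen_sub gen_labelP /=.
  have -> : h (gen_index x, gen_label x) = val x.
    by rewrite /h /gen_index /gen_label; case: (val x) => ? [].
  by rewrite valK eqxx.
move=> [[S s] l] /= /andP[Sd lO]; rewrite insubT //= ?Sd //.
Qed.

Lemma run1 (O : {set vertex D}) c l m : m \in labellings (toggle O c) ->
  run O [:: c] l m = saddle O c l m.
Proof.
move=> mO; rewrite /= (bigD1 m) //= eqxx mulr1 big1 ?addr0 // => k /andP[_].
by move=> /negPf ->; rewrite mulr0.
Qed.

Lemma run_cone_coef x y : cone_coef x y =
  \sum_k if move_ok k (gen_index x) && (gen_index y == move k (gen_index x))
         then run (smoothing_at (gen_index x)) (move_word k) (gen_label x) (gen_label y)
         else 0.
Proof.
pose O := smoothing_at (gen_index x).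
have lab_y k : move_ok k (gen_index x) -> gen_index y == move k (gen_index x) ->
    gen_label y \in labellings (toggles O (move_word k)).
  by move=> ok /eqP eqy; rewrite -smoothing_move // -eqy gen_labelP.
rewrite -(pair_bigA _ (fun c g =>
  if move_ok (c, g) (gen_index x) && (gen_index y == move (c, g) (gen_index x))
  then run O (move_word (c, g)) (gen_label x) (gen_label y) else 0)) /=.
under eq_bigr do rewrite big_bool.
rewrite big_split /= addrC /cone_coef; move: lab_y; rewrite {}/O.
rewrite /gen_label /gen_index.
case: (val x) (val y) => [S0 [s0 l]] [S1 [s1 l']] /= lab_y; congr (_ + _).
  have [eqS|neqS] := eqVneq S1 S0; last first.
    rewrite big1 // => c _; rewrite /move /= xpair_eqE (negPf neqS) /=.
    by rewrite andbF.
  rewrite /diff_coef big_mkcond /=; apply: eq_bigr => c _.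
  have := lab_y (c, false).
  rewrite /move_ok /move /= xpair_eqE eqS eqxx /=.
  case: (c \notin s0) => //= /(_ isT); case: (s1 == _) => // /(_ isT) lab.
  by rewrite -run1.
rewrite big_mkcond /=; apply: eq_bigr => b _.
have := lab_y (b, true).
rewrite /move_ok /move /= xpair_eqE /genus1_coef.
case: (b \in dblpts D :\: S0) => //=.
case: (S1 == _) => //=; last by rewrite andbF.
case: (b \in s0) => //= /(_ isT); case: (s1 == _) => // /(_ isT).
move=> lab; apply: eq_bigr => m mO; congr (_ * _); symmetry; exact: run1.
Qed.

Lemma sum_symmetric_F2 (I : finType) (F : I -> I -> 'F_2) :
  (forall i j, F i j = F j i) -> (forall i, F i i = 0) ->
  \sum_i \sum_j F i j = 0.
Proof.
move=> symF diagF; pose lt (i j : I) := (enum_rank i < enum_rank j)%N.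
have split i : \sum_j F i j = \sum_(j | lt i j) F i j + \sum_(j | lt j i) F i j.
  rewrite (bigD1 i) //= diagF add0r (bigID (lt i)) /=; congr (_ + _).
    apply: eq_bigl => j; rewrite /lt; case: ltnP => ij; rewrite ?andbF ?andbT //.
    by apply: contraTneq ij => ->; rewrite ltnn.
  apply: eq_bigl => j; rewrite /lt; case: ltngtP => ij; rewrite ?andbF ?andbT //.
    by apply: contraTneq ij => ->; rewrite ltnn.
  by have/enum_rank_inj -> := ord_inj ij; rewrite eqxx.
under eq_bigr do rewrite split.
rewrite big_split /= [X in _ + X](exchange_big_dep xpredT) //=.
by under [X in _ + X]eq_bigr do under eq_bigr do rewrite symF; rewrite F2_addxx.
Qed.

(** The composition of two moves at different vertices cancels against that of
    the same moves in the other order, by commutation of saddles.  Two moves at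
    the same vertex never follow each other, except for a crossing move and a
    genus-1 move; their composition is a triple saddle. *)
Lemma cone_coef_square x z : \sum_(y : cone_gen D) cone_coef x y * cone_coef y z = 0.
Proof.
set p := gen_index x; set l := gen_label x.
pose F k k' : 'F_2 :=
  if [&& move_ok k p, move_ok k' (move k p) & gen_index z == move k' (move k p)]
  then run (smoothing_at p) (move_word k ++ move_word k') l (gen_label z) else 0.
suff -> : \sum_(y : cone_gen D) cone_coef x y * cone_coef y z = \sum_k \sum_k' F k k'.
  have F0 k k' : k.1 = k'.1 -> F k k' = 0.
    rewrite {}/F; case: k k' => c g [_ g'] /= <-; case: ifP => // /and3P[].
    have lz := gen_labelP z.
    case: g g' => -[] ok ok' /eqP eqz.
    - by move: ok'; rewrite /move_ok /move /= !inE eqxx.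
    - rewrite run3 ?gen_labelP //; move: lz; rewrite eqz !smoothing_move //.
      by rewrite /toggles /= toggleK.
    - rewrite run3 ?gen_labelP //; move: lz; rewrite eqz !smoothing_move //.
      by rewrite /toggles /= toggleK.
    - by move: ok'; rewrite /move_ok /move /= !inE eqxx.
  apply: sum_symmetric_F2 => [k k'|k]; last exact: F0.
  have [eqk|neqk] := eqVneq k.1 k'.1; first by rewrite !F0.
  rewrite /F !andbA move_okC // moveC //; case: ifP => // _.
  by rewrite run_catC // gen_labelP.
under eq_bigr => y _ do rewrite !run_cone_coef big_distrl /=.
rewrite exchange_big /=; apply: eq_bigr => k _.
under eq_bigr => y _ do rewrite big_distrr /=.
rewrite exchange_big /=; apply: eq_bigr => k' _.
rewrite (big_cone_gen (fun p' m =>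
  (if move_ok k p && (p' == move k p) then
     run (smoothing_at p) (move_word k) l m else 0) *
  (if move_ok k' p' && (gen_index z == move k' p') then
     run (smoothing_at p') (move_word k') m (gen_label z) else 0))) /=.
rewrite /F; have [ok|nok] /= := boolP (move_ok k p); last first.
  by rewrite big1 // => p' _; rewrite big1 // => m _; rewrite mul0r.
rewrite (bigD1 (move k p)) ?move_sub ?gen_sub //= eqxx.
rewrite [X in _ + X]big1 ?addr0; last first.
  by move=> p' /andP[_ /negPf ->]; rewrite big1 // => m _; rewrite mul0r.
case: ifP => _; last by rewrite big1 // => m _; rewrite mulr0.
by rewrite smoothing_move // -run_cat // gen_labelP.
Qed.

End ConeMoves.

(** * Degrees *)

Section Degree.
Variable G : curve.
Implicit Types (O : {set vertex G}) (c v : vertex G) (x y : point G).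
Implicit Types (l m : labelling G).

Lemma root_near O c x : near O c x -> x \in roots (adj O) ->
  (x == fingraph.root (adj O) (sw c)) || (x == fingraph.root (adj O) (ne c)).
Proof.
move=> nx /eqP <-; case/orP: nx => /(fingraph.rootP (adj_connect_sym O)) ->.
  by rewrite eqxx.
by rewrite eqxx orbT.
Qed.

(** The labels of the circles through [c] can be read off at the two arcs; when
    the arcs are joined there is only one such circle. *)
Lemma degA_near O c l : l \in labellings O ->
  degA O l = \sum_(x | (x \in roots (adj O)) && ~~ near O c x)
               (if l x then -1 else 1)
             + (if l (sw c) then -1 else 1)
             + (if joined O c then 0 else if l (ne c) then -1 else 1).
Proof.
move=> lO; have sC := adj_connect_sym O.
set rs := fingraph.root (adj O) (sw c); set rn := fingraph.root (adj O) (ne c).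
have rsP : rs \in roots (adj O) by exact: roots_root.
have rnP : rn \in roots (adj O) by exact: roots_root.
have nrs : near O c rs by rewrite -(near_connect c (connect_root _ (sw c))) near_sw.
have nrn : near O c rn by rewrite -(near_connect c (connect_root _ (ne c))) near_ne.
have rsn : (rn == rs) = joined O c.
  by rewrite /joined -(root_connect sC) eq_sym.
rewrite /degA (bigD1 rs) //= -(labelling_connect lO (connect_root _ _)).
rewrite addrC [RHS]addrAC; congr (_ + _).
have [J|nJ] := boolP (joined O c).
  rewrite addr0; apply: eq_bigl => x; case: (boolP (x \in roots _)) => //= xr.
  apply/idP/idP => [|fx]; last by apply: contra fx => /eqP ->.
  apply: contra => /root_near/(_ xr); rewrite -/rs -/rn.
  have -> : rn = rs by apply/eqP; rewrite rsn.
  by rewrite orbb.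
rewrite (bigD1 rn) /=; last by rewrite rnP rsn.
rewrite -(labelling_connect lO (connect_root _ _)) addrC; congr (_ + _).
apply: eq_bigl => x; case: (boolP (x \in roots _)) => //= xr.
apply/idP/idP => [|fx].
  rewrite -negb_or; apply: contra => /root_near/(_ xr); exact.
by apply/andP; split; apply: contra fx => /eqP ->.
Qed.

Lemma roots_far O c x : ~~ near O c x ->
  (x \in roots (adj (toggle O c))) = (x \in roots (adj O)).
Proof.
move=> fx; rewrite !inE /fingraph.roots /= /fingraph.root.
by rewrite (eq_pick (fun y => connect_far y fx)).
Qed.

(** Both mu and Delta have degree -1. *)
Lemma saddle_degA O c l l' :
  l \in labellings O -> l' \in labellings (toggle O c) ->
  saddle O c l l' != 0 -> degA (toggle O c) l' = degA O l - 1.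
Proof.
move=> lO lO'; rewrite saddleE; have [/= /forallP agree|] := boolP (agree_far _ _ _ _).
  rewrite !(@degA_near _ c) //.
  have -> : \sum_(x | (x \in roots (adj (toggle O c))) && ~~ near (toggle O c) c x)
               (if l' x then -1 else 1) =
            \sum_(x | (x \in roots (adj O)) && ~~ near O c x)
               (if l x then -1 else 1) :> int.
    apply: eq_big => [x|x /andP[_]]; rewrite near_toggle.
      by have [//|fx] := boolP (near O c x); rewrite ?andbF // roots_far.
    by move=> fx; have := agree x; rewrite fx => /eqP ->.
  move: (\sum_(x | _) _) => d.
  have [J|nJ] /= := boolP (joined O c).
    have [//|nJ'] := boolP (joined _ _).
    by case: (l _) (l' _) (l' _) => -[] [] //= _; lia.
  have J' := joined_toggle nJ; rewrite J'.
  by case: (l _) (l _) (l' _) => -[] [] //= _; lia.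
by rewrite eqxx.
Qed.

Lemma sum_neq0 (I : finType) (P : pred I) (F : I -> 'F_2) :
  \sum_(i | P i) F i != 0 -> exists2 i, P i & F i != 0.
Proof.
move=> nz; apply/exists_inP; apply: contraR nz.
rewrite negb_exists_in => /forall_inP F0; apply/eqP/big1 => i /F0.
by rewrite negbK => /eqP.
Qed.

Lemma run_degA O w l l' : l \in labellings O -> run O w l l' != 0 ->
  degA (toggles O w) l' = degA O l - (size w)%:Z.
Proof.
elim: w O l => [|c w IH] O l lO.
  by rewrite /=; case: (eqVneq l l') => [-> _|_]; rewrite ?subr0 ?eqxx.
case/sum_neq0 => m mO; rewrite mulf_eq0 negb_or => /andP[s r].
rewrite /= -/(toggles _ w) (IH _ m) // (saddle_degA lO mO s); lia.
Qed.
End Degree.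

Section Bidegree.
Variable D : sdiagram.
Implicit Types (S s : {set vertex D}) (p : cone_index D).
Implicit Types (x y : cone_gen D) (l : labelling D).

(** The contribution of the index to the bidegree.  A positively resolved double
    point adds 1 to [npos]; a negatively resolved one adds 1 to [nneg], and
    shifts the homological degree by -1 once more in the cone. *)
Definition index_shift p : int * int :=
  let n : int := (nneg D)%:Z + #|dblpts D :\: p.1|%:Z in
  (#|p.2|%:Z - n - #|dblpts D :\: p.1|%:Z,
   #|p.2|%:Z - n *+ 2 + ((npos D)%:Z + #|p.1|%:Z)).

Lemma nneg_resolve S : nneg (resolve S) = (nneg D + #|dblpts D :\: S|)%N.
Proof.
rewrite /nneg -cardsUI [X in (_ + X)%N](_ : _ = 0)%N ?addn0.
  apply: eq_card => v; rewrite !inE ffunE inE.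
  by case: (mark D v) => [[]|]; case: (v \in S).
apply/eqP; rewrite cards_eq0; apply/eqP/setP => v; rewrite !inE.
by case: (mark D v) => [[]|]; rewrite ?andbF.
Qed.

Lemma npos_resolve S : S \subset dblpts D ->
  npos (resolve S) = (npos D + #|S|)%N.
Proof.
move=> Sd; rewrite /npos -cardsUI [X in (_ + X)%N](_ : _ = 0)%N ?addn0.
  apply: eq_card => v; rewrite !inE ffunE.
  have := subsetP Sd v; rewrite inE.
  by case: (v \in S) => [/(_ isT) ->|_] //; case: (mark D v) => [[]|].
apply/eqP; rewrite cards_eq0; apply/eqP/setP => v; rewrite !inE.
have := subsetP Sd v; rewrite inE.
by case: (v \in S) => [/(_ isT)/eqP ->|_]; rewrite ?andbF.
Qed.

Lemma cone_bidegE x : cone_bideg x =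
  ((index_shift (gen_index x)).1,
   degA (smoothing_at (gen_index x)) (gen_label x) + (index_shift (gen_index x)).2).
Proof.
have := gen_sub x; rewrite /cone_bideg /bideg /index_shift /gen_index /gen_label.
case: (val x) => S [s l] /= Sd.
by rewrite nneg_resolve npos_resolve // !PoszD !addrA.
Qed.

Lemma index_shift_move k p : move_ok k p ->
  index_shift (move k p) =
  ((index_shift p).1 + 1, (index_shift p).2 + (size (move_word k))%:Z).
Proof.
case: k p => c g [S s]; rewrite /move_ok /move /move_word /index_shift /=.
case: g => /= [/andP[cdS cs]|cs]; last first.
  by rewrite cardsU1 cs; congr pair; lia.
have -> : #|dblpts D :\: S| = #|dblpts D :\: (c |: S)|.+1.
  rewrite (cardsD1 c) cdS add1n; congr (_.+1); apply: eq_card => v.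
  by rewrite !inE negb_or andbA.
have cS : c \notin S by case/setDP: cdS.
rewrite cardsU1 cS (cardsD1 c s) cs; congr pair; lia.
Qed.

(** A crossing move loses 1 in the degree of the labelling and gains 1 in the
    size of the state.  A genus-1 move loses 2 and 1 there, and regains 3 since a
    negative crossing becomes positive. *)
Lemma cone_coef_bideg x y : cone_coef x y != 0 ->
  cone_bideg y = ((cone_bideg x).1 + 1, (cone_bideg x).2).
Proof.
rewrite run_cone_coef => /sum_neq0[k _]; case: ifP => [/andP[ok /eqP eqy]|]; last first.
  by rewrite eqxx.
move/(run_degA (gen_labelP x)); rewrite !cone_bidegE eqy smoothing_move // => ->.
by rewrite index_shift_move //=; congr pair; lia.
Qed.
End Bidegree.

(** * Euler characteristic of a finite based complex *)

Section BasedComplex.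
Variables (F : fieldType) (I : finType) (c : I -> I -> F) (deg : I -> int * int).
Hypothesis c_square : forall x z, \sum_y c x y * c y z = 0.
Hypothesis c_deg : forall x y, c x y != 0 -> deg y = ((deg x).1 + 1, (deg x).2).

Local Notation V := ({ffun I -> F^o} : vectType F).
Implicit Types (x y z : I) (f : V) (i j : int).

Definition coef_map f : V := [ffun y => \sum_x f x * c x y].

Lemma coef_map_is_linear : linear coef_map.
Proof.
move=> a f g; apply/ffunP => y; rewrite !ffunE /GRing.scale /= big_distrr /=.
rewrite -big_split /=; apply: eq_bigr => x _.
by rewrite !ffunE mulrDl mulrA.
Qed.

HB.instance Definition _ :=
  GRing.isLinear.Build F V V _ coef_map coef_map_is_linear.

Definition boundary : 'End(V) := linfun coef_map.

Definition basis_vector x : V := [ffun y => (y == x)%:R].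

Definition homogeneous i j : {vspace V} :=
  <<[seq basis_vector x | x <- enum I & deg x == (i, j)]>>%VS.

Definition dim_homology i j : nat :=
  \dim ((lker boundary :&: homogeneous i j)
        :\: (boundary @: homogeneous (i - 1) j))%VS.

Lemma boundary_square f : boundary (boundary f) = 0.
Proof.
rewrite !lfunE /=; apply/ffunP => z; rewrite !ffunE.
under eq_bigr => y _ do rewrite ffunE big_distrl /=.
rewrite exchange_big big1 //= => x _.
under eq_bigr => y _ do rewrite -mulrA.
by rewrite -big_distrr /= c_square mulr0.
Qed.

Lemma boundary_basis x :
  boundary (basis_vector x) = \sum_y c x y *: basis_vector y.
Proof.
rewrite lfunE /=; apply/ffunP => y; rewrite sum_ffunE ffunE.
rewrite (bigD1 x) //= ffunE eqxx mul1r big1 ?addr0 => [|z /negPf zx]; last first.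
  by rewrite ffunE zx mul0r.
rewrite (bigD1 y) //= !ffunE eqxx big1 ?addr0 => [|z /negPf zx]; last first.
  by rewrite !ffunE eq_sym zx; apply: mulr0.
by symmetry; apply: mulr1.
Qed.

Lemma basis_homogeneous x i j : deg x = (i, j) -> basis_vector x \in homogeneous i j.
Proof.
by move=> xij; apply/memv_span/map_f; rewrite mem_filter xij eqxx mem_enum.
Qed.

Lemma boundary_homogeneous i j :
  (boundary @: homogeneous i j <= homogeneous (i + 1) j)%VS.
Proof.
rewrite limg_span; apply/span_subvP => f /mapP[g /mapP[x]].
rewrite mem_filter => /andP[/eqP xij _] -> ->; rewrite boundary_basis.
apply: memv_suml => y _; have [->|cxy] := eqVneq (c x y) 0.
  by rewrite scale0r mem0v.
by apply/memvZ/basis_homogeneous; rewrite (c_deg cxy) xij.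
Qed.

Lemma dim_homogeneous i j :
  \dim (homogeneous i j) = #|[pred x | deg x == (i, j)]|.
Proof.
rewrite /homogeneous; set s := [seq x <- enum I | _].
have -> : #|[pred x | deg x == (i, j)]| = size s.
  by rewrite size_filter -sum1_count -sum1_card big_enum_cond.
have us : uniq s by rewrite filter_uniq ?enum_uniq.
suff /eqP -> : free [seq basis_vector x | x <- s] by rewrite size_map.
apply/(freeP (X := in_tuple [seq basis_vector x | x <- s])) => /= k k0 a.
have lt_s (b : 'I_(size [seq basis_vector x | x <- s])) : (b < size s)%N.
  by case: b => b /=; rewrite size_map.
have x0 : I := tnth (in_tuple s) (Ordinal (lt_s a)).
have /ffunP/(_ (nth x0 s a)) := k0; rewrite sum_ffunE ffunE (bigD1 a) //=.
rewrite big1 => [|b ba].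
  by rewrite !ffunE (nth_map x0) // !ffunE eqxx addr0 => <-; symmetry; apply: mulr1.
rewrite !ffunE (nth_map x0) // !ffunE nth_uniq // [_ == _](negPf _) //.
  exact: mulr0.
by rewrite eq_sym.
Qed.

Definition rank i j : nat := \dim (boundary @: homogeneous i j).

(** Rank-nullity on the chains of bidegree (i, j); the boundaries are cycles, so
    the complement in [dim_homology] loses exactly their dimension. *)
Lemma dim_homologyE i j :
  (dim_homology i j + (rank i j + rank (i - 1) j) = \dim (homogeneous i j))%N.
Proof.
rewrite /dim_homology -(limg_ker_dim boundary (homogeneous i j)).
rewrite [(homogeneous i j :&: _)%VS]capvC addnCA addnC; congr (_ + _)%N.
rewrite -[RHS](dimv_cap_compl _ (boundary @: homogeneous (i - 1) j)).
rewrite addnC; congr (_ + _)%N; rewrite /rank; congr (\dim _).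
apply/esym/capv_idPr/subvP => _ /memv_imgP[f fij ->].
rewrite memv_cap memv_ker boundary_square eqxx andTb.
have := boundary_homogeneous (i - 1) j; rewrite subrK => /subvP; apply.
exact: memv_img.
Qed.

Lemma fsbig_seqT (T : choiceType) (R : nmodType) (r : seq T) (h : T -> R) :
  uniq r -> (forall u, u \notin r -> h u = 0) ->
  \sum_(u \in [set: T]%classic) h u = \sum_(u <- r) h u.
Proof.
move=> ur h0; rewrite (fsbigE r) //= => [|u _]; last exact: h0.
by apply: eq_bigl => u; rewrite classical_sets.in_setT.
Qed.

(** The sums of the ranks entering and leaving each degree cancel after shifting
    the first index by one, which changes the sign. *)
Lemma euler_homology (K : fieldType) (t : K) :
  \sum_(ij \in [set: int * int]%classic)
     (-1) ^ ij.1 * t ^ ij.2 * (dim_homology ij.1 ij.2)%:R =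
  \sum_x (-1) ^ (deg x).1 * t ^ (deg x).2.
Proof.
pose weight ij : K := (-1) ^ ij.1 * t ^ ij.2.
pose up (ij : int * int) := (ij.1 + 1, ij.2).
pose down (ij : int * int) := (ij.1 - 1, ij.2).
have upK : cancel up down by case=> i j; rewrite /up /down /= addrK.
have downK : cancel down up by case=> i j; rewrite /up /down /= subrK.
pose B := [seq deg x | x : I].
(* the bidegrees of the generators, and their successors, which may contain
   boundaries *)
pose r := undup (B ++ map up B).
have ur : uniq r := undup_uniq _.
pose n ij : K := (\dim (homogeneous ij.1 ij.2))%:R.
pose rho ij : K := (rank ij.1 ij.2)%:R.
have dim0 ij : ij \notin B -> \dim (homogeneous ij.1 ij.2) = 0%N.
  move=> nB; rewrite dim_homogeneous; apply: eq_card0 => x; rewrite inE.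
  by apply: contraNF nB => /eqP; rewrite -surjective_pairing => <-; exact: image_f.
have n0 ij : ij \notin r -> n ij = 0.
  by rewrite mem_undup mem_cat negb_or => /andP[nB _]; rewrite /n dim0.
have rho0B ij : ij \notin B -> rho ij = 0.
  move=> nB; rewrite /rho; suff -> : rank ij.1 ij.2 = 0%N by [].
  apply/eqP; rewrite -leqn0 -(dim0 _ nB).
  by rewrite /rank -(limg_ker_dim boundary (homogeneous _ _)) leq_addl.
have rho0 ij : ij \notin r -> rho ij = 0.
  by rewrite mem_undup mem_cat negb_or => /andP[nB _]; apply: rho0B.
have rho0d ij : ij \notin r -> rho (down ij) = 0.
  rewrite mem_undup mem_cat negb_or => /andP[_ nB]; apply: rho0B.
  by apply: contra nB => ijB; rewrite -[ij]downK map_f.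
have dimE ij : (dim_homology ij.1 ij.2)%:R = n ij - (rho ij + rho (down ij)).
  by rewrite /n -dim_homologyE !natrD /rho addrK.
rewrite (fsbig_seqT ur) => [|ij nr]; last first.
  by rewrite dimE n0 // rho0 // rho0d // addr0 subr0 mulr0.
under eq_bigr => ij _ do rewrite dimE -/(weight ij) mulrBr mulrDr.
rewrite sumrB big_split /=.
have -> : \sum_(ij <- r) weight ij * rho (down ij) =
          - \sum_(ij <- r) weight ij * rho ij.
  rewrite -(fsbig_seqT ur) => [|ij nr]; last by rewrite rho0d ?mulr0.
  rewrite (reindex_fsbigT up) /=; last by exists down.
  rewrite -sumrN -(fsbig_seqT ur) => [|ij nr]; last by rewrite rho0 ?mulr0 ?oppr0.
  apply: eq_fsbigr => ij _; rewrite upK -mulNr; congr (_ * _).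
  by rewrite /weight /= expfzDr ?oppr_eq0 ?oner_eq0 // expr1z mulrN1 mulNr.
rewrite subrr subr0.
transitivity (\sum_(ij <- r) \sum_x (if deg x == ij then weight ij else 0)).
  apply: eq_bigr => ij _; rewrite /n dim_homogeneous -surjective_pairing.
  by rewrite -big_mkcond sumr_const mulr_natr.
rewrite exchange_big /=; apply: eq_bigr => x _.
rewrite (bigD1_seq (deg x)) //=; last first.
  by rewrite mem_undup mem_cat image_f.
by rewrite eqxx big1 ?addr0 // => ij; rewrite eq_sym => /negPf ->.
Qed.
End BasedComplex.

Lemma eulerKh_gen (D : sdiagram) :
  eulerKh D = \sum_x (-1) ^ (cone_bideg (D := D) x).1 * q ^ (cone_bideg x).2.
Proof. exact: (euler_homology (@cone_coef_square D) (@cone_coef_bideg D) q). Qed.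

(** * The Jones polynomial and its derivatives *)

Lemma q_neq0 : q != 0.
Proof. by rewrite /q tofrac_eq0 polyX_eq0. Qed.

(** A labelling is a free choice of 1 or x on each circle, of degree 1 or -1. *)
Lemma sum_labellings (G : curve) (O : {set vertex G}) :
  \sum_(l in labellings O) q ^ degA O l = (q + q^-1) ^+ npi0 O.
Proof.
have sC := adj_connect_sym O; pose v (a : bool) : ratfun := if a then q^-1 else q.
have qE l : q ^ degA O l = \prod_(x in roots (adj O)) v (l x).
  rewrite /degA (big_morph (fun n : int => q ^ n) (id1 := 1) (op1 := *%R)) //.
    by apply: eq_bigr => x _; rewrite /v; case: (l x).
  by move=> m n; rewrite expfzDr ?q_neq0.
under eq_bigr do rewrite qE.
have -> : (q + q^-1) ^+ npi0 O = \prod_(x in roots (adj O)) \sum_a v a.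
  rewrite prodr_const big_bool addrC; congr (_ ^+ _).
  by apply: eq_card => x; rewrite !inE andbT.
rewrite (big_distr_big false) /=.
pose h (f : {ffun point G -> bool}) : labelling G :=
  [ffun x => f (fingraph.root (adj O) x)].
pose h' (l : labelling G) : {ffun point G -> bool} :=
  [ffun x => if x \in roots (adj O) then l x else false].
have rP x : fingraph.root (adj O) x \in roots (adj O) by exact: roots_root.
rewrite (reindex_onto h h') => [|l lO]; last first.
  apply/ffunP => x; rewrite !ffunE rP -(labelling_connect lO (connect_root _ _)) //.
apply: eq_big => [f|f _]; last first.
  by apply: eq_bigr => x /eqP xr; rewrite ffunE xr.
have -> : h f \in labellings O.
  by apply: labellingP => x y /(fingraph.rootP sC) xy; rewrite !ffunE xy.
apply/eqP/pfamilyP => [<-|[/supportP sf _]].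
  split=> //; apply/supportP => x xr; by rewrite ffunE (negPf xr).
apply/ffunP => x; rewrite !ffunE; case: ifP => [/eqP -> //|xr].
by rewrite sf // xr.
Qed.

(** The labellings of D_s sum to (q + q^-1)^|pi_0(D_s)|, which leaves the
    sum over states defining the polynomial of D_S; of the two shifts by the
    number of negatively resolved double points, one is part of that polynomial
    and the other is the sign. *)
Lemma euler_cone (D : sdiagram) :
  \sum_x (-1) ^ (cone_bideg (D := D) x).1 * q ^ (cone_bideg x).2 =
  \sum_(S : {set vertex D} | S \subset dblpts D)
     (-1) ^+ #|dblpts D :\: S| * jones (resolve S).
Proof.
under eq_bigr do rewrite cone_bidegE /=.
rewrite (big_cone_gen (fun p l => (-1) ^ (index_shift p).1 *
  q ^ (degA (smoothing_at p) l + (index_shift p).2))).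
have term (S : {set vertex D}) : S \subset dblpts D ->
    (-1) ^+ #|dblpts D :\: S| * jones (resolve S) =
    \sum_s \sum_(l in labellings (smoothing_at (S, s)))
      (-1) ^ (index_shift (S, s)).1 *
      q ^ (degA (smoothing_at (S, s)) l + (index_shift (S, s)).2).
  move=> Sd; rewrite /jones /bracket npos_resolve // nneg_resolve.
  rewrite !big_distrr /=; apply: eq_bigr => s _.
  rewrite -big_distrr /= (_ : npi0 _ = npi0 (smoothing_at (S, s))) // -sum_labellings.
  under [in RHS]eq_bigr do rewrite expfzDr ?q_neq0 //.
  rewrite -big_distrl /= /index_shift /=.
  move: (\sum_(l in _) _) => W.
  set n := (nneg D + _)%N; set k := #|_ :\: _|; set m := #|s|.
  have signN (a : nat) : (-1) ^ (- a%:Z) = (-1) ^+ a :> ratfun.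
    by rewrite -exprnN -exprVn invrN1.
  rewrite PoszD !expfzDr ?oppr_eq0 ?oner_eq0 ?q_neq0 // !signN.
  rewrite [(- q) ^+ m]exprNn -!exprnP.
  ring.
rewrite (eq_bigr _ term) [RHS]pair_big_dep /=.
by apply: eq_big => [[S s]|[S s] _]; rewrite ?andbT.
Qed.

(** Resolving a first double point [b] splits the subsets S into those that
    contain [b] and those that do not; the latter have one more negatively
    resolved double point. *)
Lemma derivative_resolve (B : pzRingType) (v : sdiagram -> B) r (D : sdiagram) :
  #|dblpts D| = r ->
  derivative v r D = \sum_(S : {set vertex D} | S \subset dblpts D)
     (-1) ^+ #|dblpts D :\: S| * v (resolve S).
Proof.
elim: r D => [|r IH] D Dr.
  have D0 : dblpts D = set0 by apply/eqP; rewrite -cards_eq0 Dr.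
  rewrite (big_pred1 set0) => [|S]; last by rewrite D0 subset0.
  rewrite D0 setD0 cards0 expr0 mul1r /=; congr v.
  case: D {Dr} D0 => G m pG D0; congr SDiagram; apply/ffunP => u.
  by rewrite ffunE; have /setP/(_ u) := D0; rewrite !inE => ->.
have /card_gt0P[b bD] : (0 < #|dblpts D|)%N by rewrite Dr.
rewrite (derivativeS v Dr bD).
have card_res e : #|dblpts (resolve1 (D := D) b e)| = r.
  by rewrite dblpts_resolve1; move: Dr; rewrite (cardsD1 b) bD => -[].
have resolveE e (S : {set vertex D}) : S \subset dblpts D :\ b ->
    resolve (D := resolve1 b e) S = resolve (if e then b |: S else S).
  rewrite subsetD1 => /andP[Sd bS].
  case: e; congr SDiagram; apply/ffunP => u; rewrite !ffunE dblpts_resolve1 in_setD1.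
    by have [->|ub] := eqVneq u b; rewrite ?bD ?setU11 // !inE (negPf ub).
  by have [->|ub] := eqVneq u b; rewrite ?bD ?(negPf bS).
rewrite !IH // !dblpts_resolve1 [RHS](bigID (fun S : {set vertex D} => b \in S)) /=.
rewrite -sumrN; congr (_ + _).
  rewrite [RHS](reindex_onto (fun S => b |: S) (fun S => S :\ b)) /=; last first.
    by move=> S /andP[_ bS]; rewrite setD1K.
  apply: eq_big => [S|S Sd].
    rewrite subsetD1 subUset sub1set bD setU11 andbT /=; congr (_ && _).
    apply/idP/eqP => [bS|<-]; last by rewrite !inE eqxx.
    by rewrite setU1K.
  rewrite resolveE //; congr (_ ^+ _ * _).
  by apply: eq_card => u; rewrite !inE negb_or -andbA andbCA.
apply: eq_big => [S|S Sd]; first by rewrite subsetD1.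
rewrite resolveE // -mulNr; congr (_ * _).
have bS : b \notin S by move: Sd; rewrite subsetD1 => /andP[].
rewrite (cardsD1 b (dblpts D :\: S)) inE bD bS /= exprS mulN1r; congr (- (_ ^+ _)).
by apply: eq_card => u; rewrite !inE andbCA.
Qed.

Theorem mainTheorem3 (r : nat) (D : sdiagram) (hD : #|dblpts D| = r) :
  eulerKh D = derivative jones r D.
Proof. by rewrite eulerKh_gen euler_cone (derivative_resolve jones hD). Qed.
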